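(* Let $m>0$, $\Lambda>0$ and $\alpha\ge \frac{1}{6\sqrt3\,m}$ be real numbers. For $r>0$ put $$f(r)=\sqrt{\frac{2m+\Lambda r^3/3}{r}},\qquad h(r)=1-f(r)^2=1-\frac{2m}{r}-\frac{\Lambda r^2}{3},\qquad R(r)=\alpha^2+f'(r)^2\Bigl(1-\frac1{f(r)^2}\Bigr).$$ Then $R(r)\ge 0$ for all $r>0$, and there is a choice of signs $\sigma:(0,\infty)\to\{1,-1\}$ such that $\sigma\sqrt{R}$ is smooth on $(0,\infty)$. For such a choice, let $\psi$ be an antiderivative of $\sigma\sqrt R$ on $(0,\infty)$. Then the map $y:\mathbb R\times(0,\infty)\times S^2\to\mathbb R^{1,5}$ given in coordinates $u\in\mathbb R$, $r>0$, $(\theta,\phi)\in S^2$ by $$y^0=u,\quad y^1=\frac{f(r)}{\alpha}\sin(\alpha u-\psi(r)),\quad y^2=\frac{f(r)}{\alpha}\cos(\alpha u-\psi(r)),$$ $$y^3=r\cos\theta,\quad y^4=r\sin\theta\cos\phi,\quad y^5=r\sin\theta\sin\phi$$ is a smooth embedding (in particular smooth for all $r>0$, including the zeros of $h$) which is an isometric embedding of the Schwarzschild-de Sitter metric: on each connected component of $\{r>0: h(r)\neq 0\}$, with the time coordinate $t$ defined by $$u=t-\frac1\alpha\int \frac{f(r)^2\psi'(r)}{1-f(r)^2}\,dr ,$$ the metric induced by $y$ from $\mathbb R^{1,5}$ equals $$ds^2=h(r)\,dt^2-\frac{dr^2}{h(r)}-r^2\,(d\theta^2+\sin^2\theta\,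 d\phi^2).$$
   Context: $\mathbb R^{1,5}$ denotes $\mathbb R^6$ with coordinates $y^0,\dots,y^5$ and the flat metric $\eta=(dy^0)^2-(dy^1)^2-(dy^2)^2-(dy^3)^2-(dy^4)^2-(dy^5)^2$ (signature $(+-----)$). The metric induced by a map $y$ is the pullback $g_{\mu\nu}=\partial_\mu y^a\,\partial_\nu y^b\,\eta_{ab}$. $(\theta,\phi)$ are the standard spherical coordinates on the unit sphere $S^2$; the expressions $(\cos\theta,\sin\theta\cos\phi,\sin\theta\sin\phi)$ define the standard inclusion $S^2\subset\mathbb R^3$. The indefinite integral in the relation between $u$ and $t$ means any antiderivative on the given connected component of $\{h\ne0\}$. The metric $ds^2$ is the Schwarzschild-de Sitter metric with mass $m$ and cosmological constant $\Lambda$; the positive zeros of $h$ (if any) are its horizons. *)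

(* Defs.v *)
From HB Require Import structures.
From mathcomp Require Import all_boot all_order all_algebra.
From mathcomp Require Import all_classical all_reals all_analysis.

Set Implicit Arguments.
Unset Strict Implicit.
Unset Printing Implicit Defensive.

Import Order.TTheory GRing.Theory Num.Theory.
Import numFieldNormedType.Exports.

Local Open Scope classical_set_scope.
Local Open Scope ring_scope.

(* Smoothness and embeddings for submanifolds of a normed space.
   A submanifold is given by its underlying set M; smooth maps on M are the
   maps that extend locally to smooth maps of the ambient space, and tangent
   vectors of M are the velocities of smooth curves in M. *)
Section Smooth.
Context {R : realType}.
Implicit Types V W : normedModType R.

(* f is C^k on the open set U.  In finite dimension, differentiability with
   C^k directional derivatives in every fixed direction is C^(k+1). *)
Fixpoint Ck_on V W (k : nat) (U : set V) (f : V -> W) : Prop :=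
  match k with
  | 0%N => forall x, U x -> {for x, continuous f}
  | k'.+1 => (forall x, U x -> differentiable f x) /\
             (forall v : V, Ck_on k' U (fun x => 'D_v f x))
  end.

Definition smooth_on V W (U : set V) (f : V -> W) : Prop :=
  forall k, Ck_on k U f.

Definition smooth_map V W (M : set V) (f : V -> W) : Prop :=
  forall p, M p -> exists (U : set V) (F : V -> W),
    [/\ open U, U p, smooth_on U F & forall x, U x -> M x -> F x = f x].

Definition curve_through V (M : set V) (p : V) (c : R -> V) : Prop :=
  c 0 = p /\ exists U : set R,
    [/\ open U, U 0, smooth_on U c & forall s, U s -> M (c s)].

Definition immersion V W (M : set V) (f : V -> W) : Prop :=
  forall p c, M p -> curve_through M p c ->
    derive1 c 0 != 0 -> derive1 (f \o c) 0 != 0.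

(* a homeomorphism from M onto its image, for the subspace topologies *)
Definition topological_embedding V W (M : set V) (f : V -> W) : Prop :=
  {within M, continuous f} /\
  exists g : W -> V, (forall x, M x -> g (f x) = x) /\
                     {within f @` M, continuous g}.

Definition smooth_embedding V W (M : set V) (f : V -> W) : Prop :=
  [/\ smooth_map M f, immersion M f & topological_embedding M f].

End Smooth.

Section Minkowski.
Context {R : realType}.

Definition minkowski_mx : 'M[R]_6 :=
  diag_mx (\row_(a < 6) if a == 0 then 1 else -1).

Definition minkowski (v w : 'rV[R]_6) : R :=
  \sum_(a < 6) \sum_(b < 6) v 0 a * w 0 b * minkowski_mx a b.

Definition partial n (F : 'rV[R]_n -> R) (mu : 'I_n) (x : 'rV[R]_n) : R :=
  'D_(delta_mx 0 mu) F x.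

(* components, in the coordinates x, of the metric induced by Y *)
Definition induced_metric n (Y : 'rV[R]_n -> 'rV[R]_6) (x : 'rV[R]_n)
    : 'M[R]_n :=
  \matrix_(mu, nu) \sum_(a < 6) \sum_(b < 6)
    partial (fun z => Y z 0 a) mu x * partial (fun z => Y z 0 b) nu x
    * minkowski_mx a b.

(* The metric induced on M by Y is g, where g p v w is the value at p of the
   metric on the tangent vectors v and w. *)
Definition induces_metric (V : normedModType R) (M : set V)
    (Y : V -> 'rV[R]_6) (g : V -> V -> V -> R) : Prop :=
  forall p c d, M p -> curve_through M p c -> curve_through M p d ->
    minkowski (derive1 (Y \o c) 0) (derive1 (Y \o d) 0)
    = g p (derive1 c 0) (derive1 d 0).

End Minkowski.

Section SchwarzschildDeSitter.
Context {R : realType}.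

Definition sds_f (m L : R) (r : R) : R :=
  Num.sqrt ((2 * m + L * r ^+ 3 / 3) / r).

Definition sds_h (m L : R) (r : R) : R := 1 - 2 * m / r - L * r ^+ 2 / 3.

Definition sds_R (m L alpha : R) (r : R) : R :=
  alpha ^+ 2 + (derive1 (sds_f m L) r) ^+ 2 * (1 - 1 / (sds_f m L r) ^+ 2).

(* sigma : (0, oo) -> {1, -1}; its values elsewhere are irrelevant *)
Definition smooth_sign_choice (m L alpha : R) (sigma : R -> R) : Prop :=
  (forall r, 0 < r -> sigma r = 1 \/ sigma r = -1) /\
  smooth_on [set r : R | 0 < r]
    (fun r => sigma r * Num.sqrt (sds_R m L alpha r)).

(* I * J * S^2 inside R * R * R^3, with points written (time, radius, n) *)
Definition spacetime (I J : set R) : set (R * R * 'rV[R]_3)%type :=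
  [set p : R * R * 'rV[R]_3 |
    [/\ I p.1.1, J p.1.2 & \sum_(i < 3) p.2 0 i ^+ 2 = 1]].

Definition spherical (theta phi : R) : 'rV[R]_3 :=
  \row_(i < 3) [:: cos theta; sin theta * cos phi; sin theta * sin phi]`_i.

(* The embedding at p = (u, r, n); for n = spherical theta phi the last three
   coordinates are r cos theta, r sin theta cos phi, r sin theta sin phi. *)
Definition sds_y (m L alpha : R) (psi : R -> R) (p : R * R * 'rV[R]_3)
    : 'rV[R]_6 :=
  let u := p.1.1 in let r := p.1.2 in let n := p.2 in
  \row_(a < 6) [:: u;
                   sds_f m L r / alpha * sin (alpha * u - psi r);
                   sds_f m L r / alpha * cos (alpha * u - psi r);
                   r * n 0 0; r * n 0 1; r * n 0 2%:R]`_a.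

(* integrand of the relation u = t - (1 / alpha) * G between u and t *)
Definition time_shift_integrand (m L : R) (psi : R -> R) (r : R) : R :=
  sds_f m L r ^+ 2 * derive1 psi r / (1 - sds_f m L r ^+ 2).

(* the embedding in terms of (t, r, n), where u = t - G r / alpha *)
Definition sds_y_static (m L alpha : R) (psi G : R -> R)
    (p : R * R * 'rV[R]_3) : 'rV[R]_6 :=
  sds_y m L alpha psi (p.1.1 - 1 / alpha * G p.1.2, p.1.2, p.2).

(* the same in the coordinates x = (t, r, theta, phi) *)
Definition sds_y_coord (m L alpha : R) (psi G : R -> R) (x : 'rV[R]_4)
    : 'rV[R]_6 :=
  sds_y_static m L alpha psi G
    (x 0 0, x 0 1, spherical (x 0 2%:R) (x 0 3%:R)).

(* h dt^2 - dr^2 / h - r^2 (dtheta^2 + sin^2 theta dphi^2) *)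
Definition sds_metric_coord (m L : R) (x : 'rV[R]_4) : 'M[R]_4 :=
  let r := x 0 1 in let theta := x 0 2%:R in
  diag_mx (\row_(mu < 4) [:: sds_h m L r; - (1 / sds_h m L r); - r ^+ 2;
                             - (r ^+ 2 * sin theta ^+ 2)]`_mu).

(* The same metric on R * J * S^2 without angular coordinates, hence also at
   the poles: dtheta^2 + sin^2 theta dphi^2 is the metric that S^2 inherits
   from the Euclidean R^3. *)
Definition sds_metric (m L : R) (p v w : R * R * 'rV[R]_3) : R :=
  let h := sds_h m L p.1.2 in
  h * (v.1.1 * w.1.1) - (v.1.2 * w.1.2) / h
  - p.1.2 ^+ 2 * \sum_(i < 3) v.2 0 i * w.2 0 i.

End SchwarzschildDeSitter.

(* Main.v *)
(* Since L > 0, the bound on alpha gives R(r) > 0, strictly, for every r > 0: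
   with a = 2m/r and b = L r^2/3, whose sum is f^2, this amounts to
   27 (a (2b - a))^2 (1 - a - b) < 4 (a + b)^2.  Hence the constant sign 1 is a
   smooth choice, and for any choice psi is smooth because its derivative is.
   The map y is inverted on its image by taking r to be the Euclidean norm of
   (y3, y4, y5), and it is an immersion because u, r and n can already be
   recovered from (y0, y3, y4, y5) to first order.  Both forms of the metric
   identity follow from the velocity of y along a curve: the S^2 part is handled
   by n.n = 1 and n.n' = 0, and in the helix coordinates (y1, y2) only
   sin^2 + cos^2 = 1 and psi'^2 = R enter. *)

Require Import Defs.
From HB Require Import structures.
From mathcomp Require Import all_boot all_order all_algebra.
From mathcomp Require Import all_classical all_reals all_analysis.
From mathcomp Require Import ring lra.
Import Order.TTheory GRing.Theory Num.Theory.
Import numFieldNormedType.Exports.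
Local Open Scope classical_set_scope.
Local Open Scope ring_scope.

Set Implicit Arguments.
Unset Strict Implicit.
Unset Printing Implicit Defensive.

(** * Closure properties of [Ck_on] in normed spaces *)

Section SmoothCalculus.
Context {R : realType}.
Implicit Types V W : normedModType R.

(** The difference [g - f] vanishes near [x], so it has the zero map as differential there; adding
    it to [f] transfers differentiability. *)
Lemma near_eq_differentiable V W (f g : V -> W) (x : V) :
  {near x, f =1 g} -> differentiable f x -> differentiable g x.
Proof.
move=> fg df.
have -> : g = f + (g - f) by rewrite addrC subrK.
apply: differentiableD; first exact: df.
have z0 : \forall y \near x, (g - f) y = 0.
  by apply: filterS fg => y fgy; rewrite /= -[LHS]/(g y - f y) -fgy subrr.
set z := g - f in z0 *.
have zx : z x = 0 := nbhs_singleton z0.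
have zo : z \o shift x = cst (z x) + (\0 : {linear V -> W}) +o_ 0 id.
  apply/eqaddoP => e e0; move: z0; rewrite (near_shift 0) => z0.
  apply: filterS z0 => y; rewrite /= subr0 => zy.
  rewrite -[X in `|X|]/(z (y + x) - (z x + 0)).
  by rewrite zy zx addr0 subr0 normr0 mulr_ge0 // ltW.
have c0 : continuous (\0 : {linear V -> W}) by exact: cst_continuous.
by apply/diff_locallyP; rewrite (diff_unique c0 zo).
Qed.

(** Openness of [U] turns equality on [U] into equality near each of its points, which passes to all
    directional derivatives. *)
Lemma Ck_on_eq V W k (U : set V) (f g : V -> W) :
  open U -> (forall x, U x -> f x = g x) -> Ck_on k U f -> Ck_on k U g.
Proof.
move=> oU; elim: k f g => [|k IH] f g fg.
  move=> cf x Ux; have : f @ x --> f x by exact: cf.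
  rewrite (fg x Ux) => h; apply: cvg_trans h; apply: near_eq_cvg.
  by apply: filterS (open_nbhs_nbhs (conj oU Ux)) => y; exact: fg.
have fgn x : U x -> \near x, f x = g x.
  by move=> Ux; apply: filterS (open_nbhs_nbhs (conj oU Ux)) => y; exact: fg.
move=> [df ckf]; split.
  by move=> x Ux; apply: near_eq_differentiable (df x Ux); exact: fgn.
move=> v; apply: (IH (fun x => 'D_v f x)) (ckf v) => x Ux.
by apply: near_eq_derive; exact: fgn.
Qed.

(** The inductive step of the closure lemmas: ['D_v f] may be replaced by a formula [df v] that is
    valid on [U] only. *)
Lemma Ck_on_derive V W k (U : set V) (f : V -> W) (df : V -> V -> W) :
  open U -> (forall x, U x -> differentiable f x) ->
  (forall v x, U x -> 'D_v f x = df v x) ->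
  (forall v, Ck_on k U (df v)) -> Ck_on k.+1 U f.
Proof.
move=> oU dif fE cdf; split=> // v.
by apply: Ck_on_eq (cdf v) => // x Ux; rewrite fE.
Qed.

Lemma Ck_onW V W k (U : set V) (f : V -> W) : Ck_on k.+1 U f -> Ck_on k U f.
Proof.
elim: k f => [|k IH] f [df ckf]; last by split=> // v; exact: IH.
by move=> x Ux; exact/differentiable_continuous/df.
Qed.

Lemma Ck_on_cst V W k (U : set V) (w : W) : Ck_on k U (fun=> w).
Proof.
elim: k w => [|k IH] w; first by move=> x _; exact: cst_continuous.
split=> [x _|v]; first exact: differentiable_cst.
rewrite [X in Ck_on _ _ X](_ : _ = fun=> 0); first exact: IH.
by apply/funext => x; exact: derive_cst.
Qed.

Lemma Ck_onD V W k (U : set V) (f g : V -> W) : open U ->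
  Ck_on k U f -> Ck_on k U g -> Ck_on k U (fun x => f x + g x).
Proof.
move=> oU; elim: k f g => [|k IH] f g.
  by move=> cf cg x Ux; apply: continuousD; [exact: cf|exact: cg].
move=> [df cf] [dg cg].
apply: (@Ck_on_derive _ _ _ _ _ (fun v x => 'D_v f x + 'D_v g x)) => //.
- by move=> x Ux; apply: differentiableD; [exact: df|exact: dg].
- by move=> v x Ux; apply: deriveD; apply: diff_derivable; [exact: df|exact: dg].
- by move=> v; exact: IH (cf v) (cg v).
Qed.

Lemma Ck_onM V k (U : set V) (f g : V -> R) : open U ->
  Ck_on k U f -> Ck_on k U g -> Ck_on k U (fun x => f x * g x).
Proof.
move=> oU; elim: k f g => [|k IH] f g.
  by move=> cf cg x Ux; apply: continuousM; [exact: cf|exact: cg].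
move=> ckf ckg; have [df cf] := ckf; have [dg cg] := ckg.
apply: (@Ck_on_derive _ _ _ _ _ (fun v x => f x * 'D_v g x + g x * 'D_v f x)) => //.
- by move=> x Ux; apply: differentiableM; [exact: df|exact: dg].
- by move=> v x Ux; apply: deriveM; apply: diff_derivable; [exact: df|exact: dg].
- move=> v; apply: Ck_onD => //.
    by apply: IH (cg v); exact: Ck_onW.
  by apply: IH (cf v); exact: Ck_onW.
Qed.

Lemma Ck_onZl V W k (U : set V) (f : V -> R) (w : W) : open U ->
  Ck_on k U f -> Ck_on k U (fun x => f x *: w).
Proof.
move=> oU; elim: k f => [|k IH] f.
  by move=> cf x Ux; apply: cvgZr_tmp; exact: cf.
move=> [df cf].
apply: (@Ck_on_derive _ _ _ _ _ (fun v x => 'D_v f x *: w)) => //.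
- by move=> x Ux; apply: differentiableZl; exact: df.
- move=> v x Ux; have dfx := df x Ux.
  by rewrite deriveE ?diffZl// ?deriveE//; exact: differentiableZl.
- by move=> v; exact: IH (cf v).
Qed.

Lemma Ck_on_sum V W k (U : set V) n (f : 'I_n -> V -> W) : open U ->
  (forall i, Ck_on k U (f i)) -> Ck_on k U (fun x => \sum_(i < n) f i x).
Proof.
move=> oU; elim: n f => [|n IH] f cf.
  rewrite [X in Ck_on _ _ X](_ : _ = fun=> 0); first exact: Ck_on_cst.
  by apply/funext => x; rewrite big_ord0.
rewrite [X in Ck_on _ _ X](_ : _ = fun x =>
    \sum_(i < n) f (widen_ord (leqnSn n) i) x + f ord_max x); last first.
  by apply/funext => x; rewrite big_ord_recr.
by apply: Ck_onD => //; exact: IH.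
Qed.

Lemma Ck_on_row V k (U : set V) n (f : V -> 'rV[R]_n) : open U ->
  (forall i, Ck_on k U (fun x => f x 0 i)) -> Ck_on k U f.
Proof.
move=> oU cf.
rewrite [X in Ck_on _ _ X](_ : _ = fun x => \sum_(i < n) f x 0 i *: delta_mx 0 i).
  by apply: Ck_on_sum => // i; exact: Ck_onZl.
by apply/funext => x; exact: row_sum_delta.
Qed.

(** A continuous linear map is its own differential, so each directional derivative is constant. *)
Lemma Ck_on_linear V W k (U : set V) (f : V -> W) : open U ->
  linear f -> continuous f -> Ck_on k U f.
Proof.
move=> oU lf cf.
pose fM := GRing.isLinear.Build _ _ _ _ _ lf.
pose fL : {linear V -> W} := HB.pack f fM.
have dfL x : differentiable f x by exact: (@linear_differentiable _ _ _ fL).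
case: k => [|k]; first by move=> x _; exact: cf.
apply: (@Ck_on_derive _ _ _ _ _ (fun v x => f v)) => //.
- by move=> v x _; rewrite deriveE// (@diff_lin _ _ _ fL).
- by move=> v; exact: Ck_on_cst.
Qed.

(** Induction through the chain rule: the derivative is the product of ['D_1 g], composed with [f],
    and ['D_v f]; the induction hypothesis handles the first factor. *)
Lemma Ck_on_comp V k (U : set V) (A : set R) (f : V -> R) (g : R -> R) :
  open U -> (forall x, U x -> A (f x)) ->
  Ck_on k A g -> Ck_on k U f -> Ck_on k U (fun x => g (f x)).
Proof.
move=> oU UA; elim: k g => [|k IH] g.
  move=> cg cf x Ux; apply: continuous_comp; first exact: cf.
  exact/cg/UA.
move=> [dg cg] ckf; have [df cf] := ckf.
have dgf x : U x -> differentiable (g \o f) x.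
  by move=> Ux; apply: differentiable_comp; [exact: df|exact/dg/UA].
apply: (@Ck_on_derive _ _ _ _ _ (fun v x => 'D_1 g (f x) * 'D_v f x)) => //.
- move=> v x Ux; rewrite deriveE; last exact: dgf.
  rewrite diff_comp; [|exact: df|exact/dg/UA].
  rewrite /= (diff1E (dg _ (UA _ Ux))) derive1E (deriveE _ (df _ Ux)).
  exact: mulrC.
- by move=> v; apply: Ck_onM => //; [apply: IH (cg 1) _; exact: Ck_onW|exact: cf].
Qed.

(** On the line ['D_v f] is [v *: df], so the single derivative [df] controls every direction. *)
Lemma Ck_on_R W k (U : set R) (f df : R -> W) : open U ->
  (forall x, U x -> is_derive x 1 f (df x)) -> Ck_on k U df ->
  Ck_on k.+1 U f.
Proof.
move=> oU fE cdf.
have dif x : U x -> differentiable f x.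
  by move=> /fE fx; apply/derivable1_diffP; exact: ex_derive.
have fvE v x : U x -> 'D_v f x = v *: df x.
  move=> Ux; rewrite deriveE; last exact: dif.
  rewrite (diff1E (dif _ Ux)) derive1E; congr (_ *: _).
  by have := fE x Ux => fx; exact: derive_val.
apply: (@Ck_on_derive _ _ _ _ _ (fun v x : R => v *: df x)) => // v.
elim: k df cdf {fE fvE} => [|k IH] df.
  by move=> cf x Ux; apply: cvgZl_tmp; exact: cf.
move=> [ddf cdf].
apply: (@Ck_on_derive _ _ _ _ _ (fun u x : R => v *: 'D_u df x)) => //.
- by move=> x Ux; apply: differentiableZ; exact: ddf.
- by move=> u x Ux; apply: deriveZ; apply: diff_derivable; exact: ddf.
- by move=> u; exact: IH (cdf u).
Qed.
End SmoothCalculus.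

(** * Smoothness of inverse, powers, square root, sine and cosine *)

Section SmoothElementary.
Context {R : realType}.
Implicit Types V : normedModType R.

Lemma open_neq0 : open [set x : R | x != 0].
Proof.
rewrite (_ : [set x : R | x != 0] = ~` [set 0]); last first.
  by apply/seteqP; split => x /= /eqP.
exact/closed_openC/closed_eq.
Qed.

(** The derivative is a polynomial in the inverse itself, so the induction feeds on its own
    hypothesis. *)
Lemma Ck_on_inv k : Ck_on k [set x : R | x != 0] (fun x => x^-1).
Proof.
elim: k => [|k IH]; first by move=> x; exact: inv_continuous.
apply: (@Ck_on_R _ _ _ _ _ (fun x : R => -1 * (x^-1 * x^-1))).
- exact: open_neq0.
- move=> x /= x0; apply: is_derive_eq; first exact: (is_deriveV x0).
  by rewrite [LHS]mulr1 mulN1r -invfM expr2.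
- have o := open_neq0.
  by apply: Ck_onM => //; [exact: Ck_on_cst|exact: Ck_onM].
Qed.

Lemma Ck_onV V k (U : set V) (f : V -> R) : open U ->
  (forall x, U x -> f x != 0) -> Ck_on k U f -> Ck_on k U (fun x => (f x)^-1).
Proof. by move=> oU f0; apply: Ck_on_comp f0 (Ck_on_inv k). Qed.

Lemma Ck_onX V k (U : set V) (f : V -> R) n : open U ->
  Ck_on k U f -> Ck_on k U (fun x => f x ^+ n).
Proof.
move=> oU cf; elim: n => [|n IH]; first exact: Ck_on_cst.
rewrite [X in Ck_on _ _ X](_ : _ = fun x => f x * f x ^+ n); first exact: Ck_onM.
by apply/funext => x; rewrite exprS.
Qed.

Lemma Ck_onB V k (U : set V) (f g : V -> R) : open U ->
  Ck_on k U f -> Ck_on k U g -> Ck_on k U (fun x => f x - g x).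
Proof.
move=> oU cf cg.
rewrite [X in Ck_on _ _ X](_ : _ = fun x => f x + -1 * g x).
  by apply: Ck_onD => //; apply: Ck_onM => //; exact: Ck_on_cst.
by apply/funext => x; rewrite mulN1r.
Qed.

Lemma Ck_on_id k (U : set R) : open U -> Ck_on k U id.
Proof. by move=> oU; apply: Ck_on_linear => // x; exact: cvg_id. Qed.

Lemma Ck_on_sqrt k : Ck_on k [set x : R | 0 < x] Num.sqrt.
Proof.
have o : open [set x : R | 0 < x] by exact: open_gt.
elim: k => [|k IH]; first by move=> x _; exact: sqrt_continuous.
apply: (@Ck_on_R _ _ _ _ _ (fun x : R => (2 * Num.sqrt x)^-1)) => //.
apply: Ck_onV => //; last by apply: Ck_onM => //; exact: Ck_on_cst.
by move=> x /= x0; rewrite mulf_neq0// gt_eqF// sqrtr_gt0.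
Qed.

(** Each function is, up to sign, the derivative of the other, hence the joint induction. *)
Lemma Ck_on_sin_cos k :
  Ck_on k [set: R] (@sin R) /\ Ck_on k [set: R] (@cos R).
Proof.
elim: k => [|k [IHs IHc]].
  by split=> x _; [exact: continuous_sin|exact: continuous_cos].
split; first exact: (@Ck_on_R _ _ _ _ _ (@cos R)) openT _ IHc.
apply: (@Ck_on_R _ _ _ _ _ (fun x : R => -1 * sin x)); first exact: openT.
  by move=> x _; rewrite mulN1r; exact: is_derive_cos.
by apply: Ck_onM IHs; [exact: openT|exact: Ck_on_cst].
Qed.
End SmoothElementary.

(* For [a = 2 m / r] and [b = L r^2 / 3] one has [f^2 = a + b] and
   [f' = (2 b - a) / (2 r f)], so that [0 < R] reduces to this bound. *)
Lemma sds_quartic_bound (R : realFieldType) (a b : R) : 0 < a -> 0 < b ->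
  27 * (a * (2 * b - a)) ^+ 2 * (1 - (a + b)) < 4 * (a + b) ^+ 2.
Proof.
move=> a0 b0; set s := a + b; have s0 : 0 < s by rewrite addr_gt0.
have s20 : 0 < s ^+ 2 by rewrite exprn_gt0.
(* For [1 <= s] the left side is nonpositive. Below 1 the sign of [2 * b - a] decides which factor
   has to be estimated. *)
have [s1|s1] := leP 1 s.
  apply: (@le_lt_trans _ _ 0); last by rewrite mulr_gt0.
  by rewrite mulr_ge0_le0 ?subr_le0// mulr_ge0// sqr_ge0.
have s1' : 0 < 1 - s by rewrite subr_gt0.
have [ba|ab] := leP (2 * b) a.
  have q : (2 * b - a) ^+ 2 < s ^+ 2 by rewrite /s; nra.
  have c : 27 * a ^+ 2 * (1 - s) <= 4.
    apply: (@le_trans _ _ (27 * a ^+ 2 * (1 - a))).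
      by rewrite ler_wpM2l ?mulr_ge0 ?sqr_ge0// /s; lra.
    (* This product expands to [4 - 27 * a ^+ 2 * (1 - a)]; the maximum is at [a = 2 / 3]. *)
    have : 0 <= (3 * a - 2) ^+ 2 * (3 * a + 1).
      by rewrite mulr_ge0 ?sqr_ge0//; lra.
    by nra.
  rewrite exprMn mulrA mulrAC.
  apply: (@lt_le_trans _ _ (27 * a ^+ 2 * (1 - s) * s ^+ 2)).
    by rewrite ltr_pM2l// !mulr_gt0// exprn_gt0.
  by rewrite ler_wpM2r// ltW.
have p0 : 0 <= a * (2 * b - a) by rewrite mulr_ge0 ?subr_ge0 ?ltW.
(* With [b = s - a] the gap between the two sides is [(3 * a - s) ^+ 2 / 3]. *)
have p1 : a * (2 * b - a) <= s ^+ 2 / 3.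
  have := sqr_ge0 (3 * a - s); rewrite /s; lra.
have p2 : (a * (2 * b - a)) ^+ 2 <= s ^+ 4 / 9.
  rewrite (_ : s ^+ 4 / 9 = (s ^+ 2 / 3) ^+ 2); last by field.
  by rewrite ler_pXn2r// nnegrE// mulr_ge0// ltW.
apply: (@le_lt_trans _ _ (3 * s ^+ 2 * (1 - s) * s ^+ 2)).
  rewrite (_ : 3 * _ * _ * _ = 27 * (s ^+ 4 / 9) * (1 - s)); last by field.
  by rewrite ler_pM2r// ler_pM2l.
(* What remains is [3 * s ^+ 2 * (1 - s) < 4], with room to spare for [0 < s < 1]. *)
rewrite ltr_pM2r//; have : s ^+ 2 < 1 by rewrite expr_lt1// ltW.
nra.
Qed.

(** * The functions f and R: derivative, positivity, smoothness *)

Section SchwarzschildDeSitter.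
Context {R : realType}.
Variables m L alpha : R.
Hypotheses (hm : 0 < m) (hL : 0 < L).
Hypothesis halpha : 1 / (6 * Num.sqrt 3 * m) <= alpha.

Lemma alpha_gt0 : 0 < alpha.
Proof.
by apply: lt_le_trans halpha; rewrite divr_gt0// !mulr_gt0// sqrtr_gt0.
Qed.

Lemma sds_F_gt0 r : 0 < r -> 0 < (2 * m + L * r ^+ 3 / 3) / r.
Proof.
by move=> r0; rewrite divr_gt0// addr_gt0 ?divr_gt0 ?mulr_gt0 ?exprn_gt0.
Qed.

Lemma sds_f_gt0 r : 0 < r -> 0 < sds_f m L r.
Proof. by move=> r0; rewrite sqrtr_gt0 sds_F_gt0. Qed.

Lemma sds_f_sqr (r : R) : 0 < r -> sds_f m L r ^+ 2 = 2 * m / r + L * r ^+ 2 / 3.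
Proof.
move=> r0; rewrite sqr_sqrtr ?ltW ?sds_F_gt0//.
by field; rewrite gt_eqF.
Qed.

Lemma sds_h_f (r : R) : 0 < r -> sds_h m L r = 1 - sds_f m L r ^+ 2.
Proof. by move=> r0; rewrite sds_f_sqr// /sds_h opprD addrA. Qed.

Lemma is_derive_sds_f (r : R) : 0 < r ->
  is_derive r 1 (sds_f m L)
    ((2 * (L * r ^+ 2 / 3) - 2 * m / r) / (2 * r * sds_f m L r)).
Proof.
move=> r0; have rn0 : r != 0 by rewrite gt_eqF.
pose F (r : R) := (2 * m + L * r ^+ 3 / 3) / r.
have dF : is_derive r 1 F ((2 * (L * r ^+ 2 / 3) - 2 * m / r) / r).
  have d1 := is_deriveZ (2 * m) (is_deriveV (f := id) rn0 (is_derive_id r 1)).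
  have d2 := is_deriveZ (L / 3) (is_deriveX 2 (is_derive_id r 1)).
  have d := is_deriveD d1 d2.
  rewrite (_ : F = ((2 * m) \*: (fun y => (id y)^-1) + (L / 3) \*: id ^+ 2)).
    apply: (is_derive_eq d).
    by rewrite /GRing.scale /=; field.
  apply/funext => y; rewrite /F /= -[RHS]/(2 * m * y^-1 + L / 3 * (y ^+ 2)).
  (* The two expressions agree at 0 as well, because the inverse of 0 is 0; so they are equal as
     functions. *)
  have [->|y0] := eqVneq y 0; first by rewrite invr0 !mulr0 expr0n mulr0 addr0.
  by field.
have ds := is_derive1_sqrt (sds_F_gt0 r0).
have d : is_derive r 1 (sds_f m L) _ := is_derive1_comp (g := F) ds dF.
apply: (is_derive_eq d).
by rewrite -/(sds_f m L r); field; rewrite rn0 gt_eqF ?sds_f_gt0.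
Qed.

(** Replacing [alpha ^+ 2] by its lower bound [1 / (108 * m ^+ 2)] and clearing denominators leaves
    exactly [sds_quartic_bound]. Strictness matters: the square root is smooth only away from 0. *)
Lemma sds_R_gt0 r : 0 < r -> 0 < sds_R m L alpha r.
Proof.
move=> r0; have rn0 : r != 0 by rewrite gt_eqF.
rewrite /sds_R derive1E.
have -> := @derive_val _ _ _ _ _ _ _ (is_derive_sds_f r0).
have f0 := sds_f_gt0 r0; have F := sds_f_sqr r0.
set f := sds_f m L r in f0 F *.
have a0 : 0 < 2 * m / r by rewrite divr_gt0 ?mulr_gt0.
have b0 : 0 < L * r ^+ 2 / 3 by rewrite divr_gt0 ?mulr_gt0 ?exprn_gt0.
have := sds_quartic_bound a0 b0; rewrite -F.
set b := L * r ^+ 2 / 3 in b0 F *; set a := 2 * m / r in a0 F * => bd.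
(* Eliminating [r] in favour of [a] makes the inequality one in [a], [b] and [f], with [m] only as
   an overall scale. *)
have rE : r = 2 * m / a by rewrite /a; field; rewrite rn0 gt_eqF.
have a2 : 1 / (108 * m ^+ 2) <= alpha ^+ 2.
  rewrite (_ : 1 / _ = (1 / (6 * Num.sqrt 3 * m)) ^+ 2).
    rewrite ler_pXn2r// nnegrE ?(ltW alpha_gt0)//.
    by rewrite divr_ge0// !mulr_ge0 ?sqrtr_ge0// ltW.
  rewrite expr_div_n !exprMn sqr_sqrtr// expr1n; congr (_ / (_ * _)).
  by ring.
apply: (@lt_le_trans _ _ (1 / (108 * m ^+ 2) +
   ((2 * b - a) / (2 * r * f)) ^+ 2 * (1 - 1 / f ^+ 2))); last first.
  by rewrite lerD2r.
clearbody a b f; rewrite [X in 0 < X](_ : _ = (4 * f ^+ 2 ^+ 2 - 27 * (a * (2 * b - a)) ^+ 2 * (1 - f ^+ 2))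
   / (432 * m ^+ 2 * f ^+ 2 ^+ 2)); last first.
  by rewrite rE; field; rewrite !gt_eqF.
apply: divr_gt0; first by rewrite subr_gt0.
apply: mulr_gt0; last exact/exprn_gt0/exprn_gt0.
by apply: mulr_gt0; [rewrite ltr0n|exact: exprn_gt0].
Qed.

Lemma Ck_on_sds_f k : Ck_on k [set r : R | 0 < r] (sds_f m L).
Proof.
have o : open [set r : R | 0 < r] by exact: open_gt.
have c (a : R) : Ck_on k [set r : R | 0 < r] (fun=> a) by exact: Ck_on_cst.
have i : Ck_on k [set r : R | 0 < r] id by exact: Ck_on_id.
rewrite /sds_f; apply: Ck_on_comp (@Ck_on_sqrt R k) _ => //.
  by move=> r /=; exact: sds_F_gt0.
apply: Ck_onM => //; last by apply: Ck_onV => // r /= r0; rewrite gt_eqF.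
by apply: Ck_onD => //; apply: Ck_onM => //; apply: Ck_onM => //; exact: Ck_onX.
Qed.

Lemma Ck_on_sds_R k : Ck_on k [set r : R | 0 < r] (sds_R m L alpha).
Proof.
have o : open [set r : R | 0 < r] by exact: open_gt.
have c (a : R) : Ck_on k [set r : R | 0 < r] (fun=> a) by exact: Ck_on_cst.
have df : Ck_on k [set r : R | 0 < r] (derive1 (sds_f m L)).
  rewrite [X in Ck_on _ _ X](_ : _ = 'D_1 (sds_f m L)).
    by have [_ +] := Ck_on_sds_f k.+1; exact.
  by apply/funext => r; rewrite derive1E.
rewrite /sds_R; apply: Ck_onD => //; apply: Ck_onM => //; first exact: Ck_onX.
apply: Ck_onB => //; apply: Ck_onM => //; apply: Ck_onV => //.
  by move=> r /= r0; rewrite expf_neq0// gt_eqF// sds_f_gt0.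
by apply: Ck_onX => //; exact: Ck_on_sds_f.
Qed.

Lemma smooth_sign_choice1 : smooth_sign_choice m L alpha (fun=> 1).
Proof.
split=> [r _|k]; first by left.
have o : open [set r : R | 0 < r] by exact: open_gt.
apply: Ck_onM => //; first exact: Ck_on_cst.
by apply: Ck_on_comp (@Ck_on_sqrt R k) (Ck_on_sds_R k) => // r; exact: sds_R_gt0.
Qed.

End SchwarzschildDeSitter.

(** * Coordinates on the ambient space and derivatives along curves *)

Section SpacetimeCoordinates.
Context {R : realType}.
Implicit Types (U : set (R * R * 'rV[R]_3)%type).

Lemma Ck_on_time k U : open U -> Ck_on k U (fun p => p.1.1).
Proof.
move=> oU; apply: Ck_on_linear => //.
by move=> p; apply: cvg_comp; [exact: cvg_fst|exact: cvg_fst].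
Qed.

Lemma Ck_on_radius k U : open U -> Ck_on k U (fun p => p.1.2).
Proof.
move=> oU; apply: Ck_on_linear => //.
by move=> p; apply: cvg_comp; [exact: cvg_fst|exact: cvg_snd].
Qed.

Lemma linear_coord n (i : 'I_n) : linear (fun v : 'rV[R]_n => v 0 i).
Proof. by move=> a v w; rewrite !mxE. Qed.

Lemma Ck_on_direction k U i : open U -> Ck_on k U (fun p => p.2 0 i).
Proof.
move=> oU; apply: Ck_on_linear => //.
  by move=> a v w; exact: linear_coord.
move=> p; apply: (@cvg_comp _ _ _ snd (fun v : 'rV[R]_3 => v 0 i)).
    exact: cvg_snd.
  exact: coord_continuous.
Qed.

Lemma open_positive_radius :
  open [set p : R * R * 'rV[R]_3 | 0 < p.1.2].
Proof.
apply: (@open_comp _ _ (fun p : R * R * 'rV[R]_3 => p.1.2) [set r | 0 < r]).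
  by move=> p _; apply: cvg_comp; [exact: cvg_fst|exact: cvg_snd].
exact: open_gt.
Qed.

Lemma is_derive_row n (f : R -> 'rV[R]_n) (s : R) (d : 'rV[R]_n) :
  (forall i, is_derive s 1 (fun x => f x 0 i) (d 0 i)) -> is_derive s 1 f d.
Proof.
move=> fd; have df : derivable f s 1.
  by apply/derivable_mxP => i j; rewrite ord1; have [] := fd j.
apply: DeriveDef => //; rewrite derive_mx//; apply/rowP => i; rewrite mxE.
by have [_ ->] := fd i.
Qed.

Lemma is_derive_linear (V W : normedModType R) (f : V -> W) (c : R -> V) (s : R) dc :
  linear f -> continuous f -> is_derive s 1 c dc ->
  is_derive s 1 (f \o c) (f dc).
Proof.
move=> lf cf [/derivable1_diffP cs <-].
pose fM := GRing.isLinear.Build _ _ _ _ _ lf.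
pose fL : {linear V -> W} := HB.pack f fM.
have fcs : differentiable f (c s) by exact: (@linear_differentiable _ _ _ fL).
have dfc : differentiable (f \o c) s by exact: differentiable_comp.
apply: DeriveDef; first exact: diff_derivable.
by rewrite deriveE// diff_comp// (@diff_lin _ _ _ fL)//= deriveE.
Qed.

(** Turns partial derivatives into velocities along straight lines, so that one velocity formula
    serves both forms of the metric identity. *)
Lemma derive_line (V W : normedModType R) (f : V -> W) x v :
  'D_v f x = 'D_1 (fun h : R => f (h *: v + x)) 0.
Proof.
rewrite /derive; set d := fun h => h^-1 *: _; set d' := fun h => h^-1 *: _.
suff -> : d = d' by [].
apply/funext => h; rewrite /d /d' /=.
by rewrite addr0 scale0r add0r [_%:A]mulr1.
Qed.

Variable c : R -> R * R * 'rV[R]_3.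
Variables (s : R) (v : R * R * 'rV[R]_3).
Hypothesis cv : is_derive s 1 c v.

Lemma is_derive_time : is_derive s 1 (fun x => (c x).1.1) v.1.1.
Proof.
apply: (is_derive_linear (f := fun p : R * R * 'rV[R]_3 => p.1.1)) cv => //.
by move=> p; apply: cvg_comp; [exact: cvg_fst|exact: cvg_fst].
Qed.

Lemma is_derive_radius : is_derive s 1 (fun x => (c x).1.2) v.1.2.
Proof.
apply: (is_derive_linear (f := fun p : R * R * 'rV[R]_3 => p.1.2)) cv => //.
by move=> p; apply: cvg_comp; [exact: cvg_fst|exact: cvg_snd].
Qed.

Lemma is_derive_direction i : is_derive s 1 (fun x => (c x).2 0 i) (v.2 0 i).
Proof.
apply: (is_derive_linear (f := fun p : R * R * 'rV[R]_3 => p.2 0 i)) cv => //.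
  by move=> a x y; exact: linear_coord.
move=> p; apply: (@cvg_comp _ _ _ snd (fun v : 'rV[R]_3 => v 0 i)).
    exact: cvg_snd.
  exact: coord_continuous.
Qed.

(** Differentiating [n . n = 1] at [s] gives twice [n . n' = 0]. *)
Lemma sphere_tangent :
  (\forall x \near s, \sum_(i < 3) (c x).2 0 i ^+ 2 = 1) ->
  \sum_(i < 3) (c s).2 0 i * v.2 0 i = 0.
Proof.
move=> c1.
have d : is_derive s 1 (\sum_(i < 3) (fun x => (c x).2 0 i) ^+ 2)
    (\sum_(i < 3) (2%:R * (c s).2 0 i ^+ 1) *: v.2 0 i).
  apply: is_derive_sum => i; apply: (is_derive_eq (is_deriveX 2 (is_derive_direction i))).
  by [].
have d0 : is_derive s 1 (\sum_(i < 3) (fun x => (c x).2 0 i) ^+ 2) 0.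
  apply: near_eq_is_derive (is_derive_cst (1 : R) s 1).
  by apply: filterS c1 => x <-; rewrite fct_sumE.
have := @derive_val _ _ _ _ _ _ _ d; rewrite (@derive_val _ _ _ _ _ _ _ d0).
move=> /esym e; apply: (@mulfI _ 2) => //; rewrite mulr0 -[RHS]e mulr_sumr.
by apply: eq_bigr => i _; rewrite expr1 mulrA.
Qed.

End SpacetimeCoordinates.

Lemma big_ord3 (R : nmodType) (F : 'I_3 -> R) :
  \sum_(i < 3) F i = F 0 + F 1 + F 2%:R.
Proof.
rewrite !big_ord_recr big_ord0 /= add0r; congr (F _ + F _ + F _).
all: exact: val_inj.
Qed.

Lemma big_ord4 (R : nmodType) (F : 'I_4 -> R) :
  \sum_(i < 4) F i = F 0 + F 1 + F 2%:R + F 3%:R.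
Proof.
rewrite !big_ord_recr big_ord0 /= add0r; congr (F _ + F _ + F _ + F _).
all: exact: val_inj.
Qed.

(** The metric matrix is diagonal, so the double sum collapses. Entries come from sequences so that
    explicit lists reduce by computation. *)
Lemma minkowski_row (R : realType) (v w : seq R) :
  Defs.minkowski (\row_(a < 6) v`_a) (\row_(a < 6) w`_a) =
  v`_0 * w`_0 - v`_1 * w`_1 - v`_2 * w`_2
  - (v`_3 * w`_3 + v`_4 * w`_4 + v`_5 * w`_5).
Proof.
rewrite /Defs.minkowski.
transitivity (\sum_(a < 6) v`_a * w`_a * (if a == 0 then 1 else -1)).
  apply: eq_bigr => a _; rewrite (bigD1 a)//= big1 ?addr0.
    by rewrite /minkowski_mx !mxE eqxx mulr1n.
  by move=> b ba; rewrite /minkowski_mx !mxE (eq_sym a b) (negbTE ba) mulr0n mulr0.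
rewrite !big_ord_recl big_ord0 /= !mulrN1 mulr1 addr0 -!opprD.
by rewrite !addrA !opprD !addrA.
Qed.

(** * Velocity of the embedding and its Minkowski products *)

Section Velocity.
Context {R : realType}.
Variables m L alpha : R.
Hypotheses (hm : 0 < m) (hL : 0 < L) (alpha0 : 0 < alpha).

(** The differential of [sds_y] at [p] applied to [v]. The derivative of [psi] enters as a number
    [dpsi], which keeps the later identities purely algebraic. *)
Definition sds_velocity (psi : R -> R) (dpsi : R)
    (p v : R * R * 'rV[R]_3) : 'rV[R]_6 :=
  let phase := alpha * p.1.1 - psi p.1.2 in
  let dphase := alpha * v.1.1 - dpsi * v.1.2 in
  let amp := sds_f m L p.1.2 / alpha in
  let damp := derive1 (sds_f m L) p.1.2 * v.1.2 / alpha in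
  \row_(a < 6) [:: v.1.1; damp * sin phase + amp * cos phase * dphase;
                   damp * cos phase - amp * sin phase * dphase;
                   v.1.2 * p.2 0 0 + p.1.2 * v.2 0 0;
                   v.1.2 * p.2 0 1 + p.1.2 * v.2 0 1;
                   v.1.2 * p.2 0 2%:R + p.1.2 * v.2 0 2%:R]`_a.

(** The hypotheses on [c] are componentwise so that the lemma also applies to time-shifted curves
    and to coordinate lines. *)
Lemma is_derive_sds_y (psi : R -> R) (c : R -> R * R * 'rV[R]_3) (s : R)
    (v : R * R * 'rV[R]_3) (dpsi : R) :
  0 < (c s).1.2 -> is_derive ((c s).1.2) 1 psi dpsi ->
  is_derive s 1 (fun x => (c x).1.1) v.1.1 ->
  is_derive s 1 (fun x => (c x).1.2) v.1.2 ->
  (forall i, is_derive s 1 (fun x => (c x).2 0 i) (v.2 0 i)) ->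
  is_derive s 1 (fun x => sds_y m L alpha psi (c x)) (sds_velocity psi dpsi (c s) v).
Proof.
move=> r0 dps dt dr dn; apply: is_derive_row.
have df : is_derive s 1 (fun x => sds_f m L (c x).1.2 / alpha)
    (derive1 (sds_f m L) (c s).1.2 * v.1.2 / alpha).
  have fr : is_derive (c s).1.2 1 (sds_f m L) (derive1 (sds_f m L) (c s).1.2).
    rewrite derive1E; apply: derivableP.
    by have fr := is_derive_sds_f hm hL r0; exact: ex_derive.
  have d := is_derive1_comp (g := fun x => (c x).1.2) fr dr.
  have d' := is_deriveZ alpha^-1 d.
  rewrite (_ : (fun x => _) = alpha^-1 \*: (sds_f m L \o fun x => (c x).1.2)).
    by apply: (is_derive_eq d'); exact: mulrC.
  by apply/funext => x; exact: mulrC.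
have dphase : is_derive s 1 (fun x => alpha * (c x).1.1 - psi (c x).1.2)
    (alpha * v.1.1 - dpsi * v.1.2).
  have d := is_derive1_comp (g := fun x => (c x).1.2) dps dr.
  exact: is_deriveB (is_deriveZ alpha dt) d.
have dsin := is_derive1_comp
  (g := fun x => alpha * (c x).1.1 - psi (c x).1.2) (is_derive_sin _) dphase.
have dcos := is_derive1_comp
  (g := fun x => alpha * (c x).1.1 - psi (c x).1.2) (is_derive_cos _) dphase.
have drn i : is_derive s 1 (fun x => (c x).1.2 * (c x).2 0 i)
    (v.1.2 * (c s).2 0 i + (c s).1.2 * v.2 0 i).
  apply: (is_derive_eq (is_deriveM dr (dn i))).
  by rewrite /GRing.scale /= addrC [v.1.2 * _]mulrC.
case=> [[|[|[|[|[|[|//]]]]]] i6]; rewrite mxE.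
- rewrite [X in is_derive _ _ X](_ : _ = fun x => (c x).1.1)//.
  by apply/funext => x; rewrite mxE.
- rewrite [X in is_derive _ _ X](_ : _ = fun x => sds_f m L (c x).1.2 / alpha *
    sin (alpha * (c x).1.1 - psi (c x).1.2)).
    apply: (is_derive_eq (is_deriveM df dsin)).
    by rewrite /GRing.scale /=; ring.
  by apply/funext => x; rewrite mxE.
- rewrite [X in is_derive _ _ X](_ : _ = fun x => sds_f m L (c x).1.2 / alpha *
    cos (alpha * (c x).1.1 - psi (c x).1.2)).
    apply: (is_derive_eq (is_deriveM df dcos)).
    by rewrite /GRing.scale /=; ring.
  by apply/funext => x; rewrite mxE.
- rewrite [X in is_derive _ _ X](_ : _ = fun x => (c x).1.2 * (c x).2 0 0)//.
  by apply/funext => x; rewrite mxE.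
- rewrite [X in is_derive _ _ X](_ : _ = fun x => (c x).1.2 * (c x).2 0 1)//.
  by apply/funext => x; rewrite mxE.
- rewrite [X in is_derive _ _ X](_ : _ = fun x => (c x).1.2 * (c x).2 0 2%:R)//.
  by apply/funext => x; rewrite mxE.
Qed.


(* The time shift is chosen to cancel the mixed terms [vt * wr] and [vr * wt];
   the equation for [dpsi ^+ 2] then fixes the coefficient of [vr * wr]. *)
Lemma helical_metric (f df dpsi S C vt vr wt wr : R) :
  S ^+ 2 + C ^+ 2 = 1 -> f != 0 -> 1 - f ^+ 2 != 0 -> alpha != 0 ->
  dpsi ^+ 2 = alpha ^+ 2 + df ^+ 2 * (1 - 1 / f ^+ 2) ->
  let shift r := 1 / alpha * (f ^+ 2 * dpsi / (1 - f ^+ 2) * r) in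
  let x := alpha * (vt - shift vr) - dpsi * vr in
  let y := alpha * (wt - shift wr) - dpsi * wr in
  (vt - shift vr) * (wt - shift wr)
  - (df * vr / alpha * S + f / alpha * C * x) *
    (df * wr / alpha * S + f / alpha * C * y)
  - (df * vr / alpha * C - f / alpha * S * x) *
    (df * wr / alpha * C - f / alpha * S * y)
  = (1 - f ^+ 2) * (vt * wt) - f ^+ 2 / (1 - f ^+ 2) * (vr * wr).
Proof.
move=> SC f0 h0 a0 dpsiE /=.
set x := alpha * _ - _; set y := alpha * _ - _.
(* The terms in [S * C] from the two helix components cancel, leaving a multiple of
   [S ^+ 2 + C ^+ 2]. *)
transitivity ((vt - 1 / alpha * (f ^+ 2 * dpsi / (1 - f ^+ 2) * vr)) *
    (wt - 1 / alpha * (f ^+ 2 * dpsi / (1 - f ^+ 2) * wr)) -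
  (df ^+ 2 * (vr * wr) + f ^+ 2 * (x * y)) / alpha ^+ 2 * (S ^+ 2 + C ^+ 2)).
  by field; rewrite a0 h0.
rewrite SC mulr1 /x /y.
(* The error is written as a multiple of the equation for [dpsi ^+ 2], which then removes it. *)
transitivity ((1 - f ^+ 2) * (vt * wt) - f ^+ 2 / (1 - f ^+ 2) * (vr * wr)
  - f ^+ 2 / (1 - f ^+ 2) / alpha ^+ 2 * (vr * wr) *
    (dpsi ^+ 2 - (alpha ^+ 2 + df ^+ 2 * (1 - 1 / f ^+ 2)))).
  by field; rewrite a0 f0 h0.
by rewrite dpsiE subrr mulr0 subr0.
Qed.

(** Here [q] stands for [p] with its time moved from t to u. Time enters the velocity only through
    the phase, which disappears by [sin ^+ 2 + cos ^+ 2 = 1]. *)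
Lemma minkowski_sds_velocity (psi : R -> R) (dpsi dG : R)
    (p q v w : R * R * 'rV[R]_3) :
  q.1.2 = p.1.2 -> q.2 = p.2 ->
  0 < p.1.2 -> sds_h m L p.1.2 != 0 -> \sum_(i < 3) p.2 0 i ^+ 2 = 1 ->
  \sum_(i < 3) p.2 0 i * v.2 0 i = 0 -> \sum_(i < 3) p.2 0 i * w.2 0 i = 0 ->
  dpsi ^+ 2 = sds_R m L alpha p.1.2 ->
  dG = sds_f m L p.1.2 ^+ 2 * dpsi / (1 - sds_f m L p.1.2 ^+ 2) ->
  Defs.minkowski
    (sds_velocity psi dpsi q (v.1.1 - 1 / alpha * (dG * v.1.2), v.1.2, v.2))
    (sds_velocity psi dpsi q (w.1.1 - 1 / alpha * (dG * w.1.2), w.1.2, w.2))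
  = sds_metric m L p v w.
Proof.
move=> qr qn r0 h0 n1 nv nw dpsiE ->; rewrite minkowski_row /= qr qn.
have f0 : sds_f m L p.1.2 != 0 by rewrite gt_eqF// sds_f_gt0.
move: h0; rewrite (sds_h_f hm hL r0) => h0.
have a0 : alpha != 0 by rewrite gt_eqF.
have trig (x : R) : sin x ^+ 2 + cos x ^+ 2 = 1 by rewrite addrC cos2Dsin2.
rewrite (helical_metric _ _ _ _ (trig _) f0 h0 a0 dpsiE).
rewrite /sds_metric (sds_h_f hm hL r0).
move: n1 nv nw; rewrite !big_ord3 => n1 nv nw.
set n0 := p.2 0 0 in n1 nv nw *; set n_1 := p.2 0 1 in n1 nv nw *.
set n_2 := p.2 0 2%:R in n1 nv nw *.
set v0 := v.2 0 0 in nv *; set v1 := v.2 0 1 in nv *; set v2 := v.2 0 2%:R in nv *.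
set w0 := w.2 0 0 in nw *; set w1 := w.2 0 1 in nw *; set w2 := w.2 0 2%:R in nw *.
set f := sds_f m L p.1.2 in f0 h0 *; set r := p.1.2.
(* The product of the velocities of [r n] is sorted by [n . n], [n . w], [n . v] and [v . w]; the
   middle two vanish by tangency. *)
transitivity ((1 - f ^+ 2) * (v.1.1 * w.1.1) - f ^+ 2 / (1 - f ^+ 2) * (v.1.2 * w.1.2)
  - (v.1.2 * w.1.2 * (n0 ^+ 2 + n_1 ^+ 2 + n_2 ^+ 2)
    + v.1.2 * r * (n0 * w0 + n_1 * w1 + n_2 * w2)
    + r * w.1.2 * (n0 * v0 + n_1 * v1 + n_2 * v2)
    + r ^+ 2 * (v0 * w0 + v1 * w1 + v2 * w2))).
  by ring.
rewrite n1 nv nw !mulr0 mulr1 !addr0.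
(* The radial coefficient is [- f ^+ 2 / (1 - f ^+ 2) - 1 = - 1 / (1 - f ^+ 2)]. *)
by field.
Qed.

Lemma Ck_on_sds_y (psi : R -> R) k :
  (forall k, Ck_on k [set r : R | 0 < r] psi) ->
  Ck_on k [set p : R * R * 'rV[R]_3 | 0 < p.1.2] (sds_y m L alpha psi).
Proof.
move=> cpsi; have o := @open_positive_radius R.
set U := [set p | _].
have ct : Ck_on k U (fun p => p.1.1) by exact: Ck_on_time.
have cr : Ck_on k U (fun p => p.1.2) by exact: Ck_on_radius.
have cn i : Ck_on k U (fun p => p.2 0 i) by exact: Ck_on_direction.
have c0 (a : R) : Ck_on k U (fun=> a) by exact: Ck_on_cst.
have cf : Ck_on k U (fun p => sds_f m L p.1.2 / alpha).
  by apply: Ck_onM => //; exact: Ck_on_comp (Ck_on_sds_f hm hL k) cr.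
have cphase : Ck_on k U (fun p => alpha * p.1.1 - psi p.1.2).
  by apply: Ck_onB => //; [exact: Ck_onM|exact: Ck_on_comp (cpsi k) cr].
have [csin ccos] := @Ck_on_sin_cos R k.
apply: Ck_on_row => // -[[|[|[|[|[|[|//]]]]]] i6].
- by rewrite [X in Ck_on _ _ X](_ : _ = fun p => p.1.1)//; apply/funext => p; rewrite mxE.
- rewrite [X in Ck_on _ _ X](_ : _ = fun p => sds_f m L p.1.2 / alpha *
    sin (alpha * p.1.1 - psi p.1.2)).
    by apply: Ck_onM => //; exact: Ck_on_comp csin cphase.
  by apply/funext => p; rewrite mxE.
- rewrite [X in Ck_on _ _ X](_ : _ = fun p => sds_f m L p.1.2 / alpha *
    cos (alpha * p.1.1 - psi p.1.2)).
    by apply: Ck_onM => //; exact: Ck_on_comp ccos cphase.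
  by apply/funext => p; rewrite mxE.
- rewrite [X in Ck_on _ _ X](_ : _ = fun p : R * R * 'rV[R]_3 => p.1.2 * p.2 0 0).
    exact: Ck_onM.
  by apply/funext => p; rewrite mxE.
- rewrite [X in Ck_on _ _ X](_ : _ = fun p : R * R * 'rV[R]_3 => p.1.2 * p.2 0 1).
    exact: Ck_onM.
  by apply/funext => p; rewrite mxE.
- rewrite [X in Ck_on _ _ X](_ : _ = fun p : R * R * 'rV[R]_3 => p.1.2 * p.2 0 2%:R).
    exact: Ck_onM.
  by apply/funext => p; rewrite mxE.
Qed.

(** * The smooth embedding: immersion and continuous inverse *)

Lemma curve_through_derive (V : normedModType R) (M : set V) p (c : R -> V) :
  curve_through M p c -> is_derive (0 : R) 1 c (derive1 c 0).
Proof.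
move=> [_ [U [_ U0 cs _]]]; have [dc _] := cs 1%N.
by rewrite derive1E; apply: derivableP; apply: diff_derivable; exact: dc.
Qed.

Lemma curve_through_tangent (I J : set R) p (c : R -> R * R * 'rV[R]_3) :
  curve_through (spacetime I J) p c ->
  \sum_(i < 3) p.2 0 i * (derive1 c 0).2 0 i = 0.
Proof.
move=> cp; have [<- [U [oU U0 _ Mc]]] := cp.
apply: sphere_tangent (curve_through_derive cp) _.
by apply: filterS (open_nbhs_nbhs (conj oU U0)) => x /Mc[].
Qed.

Let positive_spacetime := spacetime [set: R] [set r : R | 0 < r].

Lemma immersion_sds_y (psi dpsi : R -> R) :
  (forall r : R, 0 < r -> is_derive r 1 psi (dpsi r)) ->
  immersion positive_spacetime (sds_y m L alpha psi).
Proof.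
move=> dps p c [_ /= r0 n1] cp; apply: contra_neq => dy0.
have cv := curve_through_derive cp; have tan := curve_through_tangent cp.
have c0 : c 0 = p by case: cp.
have r0' : 0 < (c 0).1.2 by rewrite c0.
have vel := is_derive_sds_y r0' (dps _ r0') (is_derive_time cv)
  (is_derive_radius cv) (is_derive_direction cv).
move: dy0; rewrite derive1E (@derive_val _ _ _ _ _ _ _ vel) c0 => /rowP dy0.
set v := derive1 c 0 in tan dy0 *.
have vt : v.1.1 = 0 by have := dy0 0; rewrite !mxE.
have v3 : v.1.2 * p.2 0 0 + p.1.2 * v.2 0 0 = 0.
  by have := dy0 (@Ordinal 6 3 isT); rewrite !mxE.
have v4 : v.1.2 * p.2 0 1 + p.1.2 * v.2 0 1 = 0.
  by have := dy0 (@Ordinal 6 4 isT); rewrite !mxE.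
have v5 : v.1.2 * p.2 0 2%:R + p.1.2 * v.2 0 2%:R = 0.
  by have := dy0 (@Ordinal 6 5 isT); rewrite !mxE.
move: n1 tan; rewrite !big_ord3 => n1 tan.
(* Pairing the velocity of [r n] with [n] isolates the radial component, since [n . n = 1] and
   [n . n' = 0]. *)
have vr : v.1.2 = 0.
  transitivity (p.2 0 0 * (v.1.2 * p.2 0 0 + p.1.2 * v.2 0 0) +
    p.2 0 1 * (v.1.2 * p.2 0 1 + p.1.2 * v.2 0 1) +
    p.2 0 2%:R * (v.1.2 * p.2 0 2%:R + p.1.2 * v.2 0 2%:R)).
    transitivity (v.1.2 * (p.2 0 0 ^+ 2 + p.2 0 1 ^+ 2 + p.2 0 2%:R ^+ 2) +
      p.1.2 * (p.2 0 0 * v.2 0 0 + p.2 0 1 * v.2 0 1 + p.2 0 2%:R * v.2 0 2%:R)).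
      by rewrite n1 tan mulr0 addr0 mulr1.
    by ring.
  by rewrite v3 v4 v5 !mulr0 !addr0.
move: v3 v4 v5; rewrite vr !mul0r !add0r.
have z (a : R) : p.1.2 * a = 0 -> a = 0.
  by move/eqP; rewrite mulf_eq0 gt_eqF//= => /eqP.
move=> /z v3 /z v4 /z v5.
rewrite [v]surjective_pairing [v.1]surjective_pairing vt vr; congr (_, _).
apply/rowP => -[[|[|[|//]]] i3]; rewrite mxE.
- by rewrite -[RHS]v3; congr (v.2 _ _); exact: val_inj.
- by rewrite -[RHS]v4; congr (v.2 _ _); exact: val_inj.
- by rewrite -[RHS]v5; congr (v.2 _ _); exact: val_inj.
Qed.

(* On the image of [sds_y] the norm of the last three coordinates is [r]. *)
Definition spatial_norm (y : 'rV[R]_6) : R :=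
  Num.sqrt (\sum_(i < 3) y 0 (rshift 3 i) ^+ 2).

(** A total function: the direction is 0 where [spatial_norm] vanishes, but the image of [sds_y] on
    positive radii stays away from that set. *)
Definition sds_inverse (y : 'rV[R]_6) : R * R * 'rV[R]_3 :=
  (y 0 0, spatial_norm y, \row_i (y 0 (rshift 3 i) / spatial_norm y)).

Lemma sds_y_rshift psi p i :
  sds_y m L alpha psi p 0 (rshift 3 i) = p.1.2 * p.2 0 i.
Proof.
rewrite mxE; case: i => [[|[|[|//]]] i3] /=; congr (_ * p.2 _ _).
all: exact: val_inj.
Qed.

Lemma spatial_norm_sds_y psi p : positive_spacetime p ->
  spatial_norm (sds_y m L alpha psi p) = p.1.2.
Proof.
move=> [_ /= r0 n1]; rewrite /spatial_norm.
rewrite (_ : \sum_(i < 3) _ = p.1.2 ^+ 2).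
  by rewrite sqrtr_sqr gtr0_norm.
under eq_bigr do rewrite sds_y_rshift exprMn.
by rewrite -mulr_sumr n1 mulr1.
Qed.

Lemma sds_yK psi p : positive_spacetime p ->
  sds_inverse (sds_y m L alpha psi p) = p.
Proof.
move=> Mp; rewrite /sds_inverse spatial_norm_sds_y// mxE /=.
rewrite [in RHS](surjective_pairing p) [p.1 in RHS]surjective_pairing.
congr (_, _); apply/rowP => i; rewrite mxE sds_y_rshift mulrAC mulfV ?mul1r//.
by case: Mp => _ /= r0 _; rewrite gt_eqF.
Qed.

Lemma sds_inverse_continuous (y : 'rV[R]_6) :
  0 < spatial_norm y -> {for y, continuous sds_inverse}.
Proof.
rewrite sqrtr_gt0 => y0.
pose q (y : 'rV[R]_6) : R := \sum_(i < 3) y 0 (rshift 3 i) ^+ 2.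
(* [Ck_on 0] on an open set is pointwise continuity, so the closure lemmas above yield the
   result. *)
have ccoord (U : set 'rV[R]_6) i : open U -> Ck_on 0 U (fun y => y 0 i).
  move=> oU; apply: Ck_on_linear => //.
    by move=> a v w; exact: linear_coord.
  exact: coord_continuous.
have cq U : open U -> Ck_on 0 U q.
  by move=> oU; apply: Ck_on_sum => // i; apply: Ck_onX => //; exact: ccoord.
pose U := [set y | 0 < q y].
have oU : open U.
  apply: (@open_comp _ _ q [set r | 0 < r]); last exact: open_gt.
  by move=> z _; exact: (cq _ openT).
have cn : Ck_on 0 U spatial_norm by apply: Ck_on_comp (@Ck_on_sqrt R 0) (cq _ oU).
have c1 : {for y, continuous (fun z : 'rV[R]_6 => z 0 0)}.
  exact: coord_continuous.
have crow : Ck_on 0 U (fun y : 'rV[R]_6 => \row_i (y 0 (rshift 3 i) / spatial_norm y)).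
  apply: Ck_on_row => // i.
  rewrite [X in Ck_on _ _ X](_ : _ = fun y : 'rV[R]_6 =>
      y 0 (rshift 3 i) / spatial_norm y).
    apply: Ck_onM => //; first exact: ccoord.
    by apply: Ck_onV => // z Uz; rewrite gt_eqF// sqrtr_gt0.
  by apply/funext => z; rewrite mxE.
exact: cvg_pair (cvg_pair c1 (cn y y0)) (crow y y0).
Qed.

Lemma smooth_embedding_sds_y (psi dpsi : R -> R) :
  smooth_on [set r : R | 0 < r] dpsi ->
  (forall r : R, 0 < r -> is_derive r 1 psi (dpsi r)) ->
  smooth_embedding positive_spacetime (sds_y m L alpha psi).
Proof.
move=> sdpsi dps; have o : open [set r : R | 0 < r] by exact: open_gt.
have cpsi k : Ck_on k [set r : R | 0 < r] psi.
  by apply: Ck_onW; exact: Ck_on_R dps (sdpsi k).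
have cy k := Ck_on_sds_y k cpsi.
split; [|exact: immersion_sds_y dps|split].
(* The defining formula is already smooth on the open set of positive radii, without restricting [n]
   to the sphere, and serves as its own local extension. *)
- move=> p [_ /= r0 _]; exists [set p | 0 < p.1.2], (sds_y m L alpha psi).
  by split=> //; exact: open_positive_radius.
- apply: continuous_in_subspaceT => p; rewrite inE => -[_ /= r0 _].
  exact: (cy 0%N).
- exists sds_inverse; split; first by move=> p; exact: sds_yK.
  apply: continuous_in_subspaceT => y; rewrite inE => -[p Mp <-].
  apply: sds_inverse_continuous; rewrite spatial_norm_sds_y//.
  by case: Mp.
Qed.

(** The shift from t to u is applied to the curve [c], which reduces the claim to
    [is_derive_sds_y]. *)
Lemma is_derive_sds_y_static (psi G : R -> R) (c : R -> R * R * 'rV[R]_3)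
    (s : R) (v : R * R * 'rV[R]_3) (dpsi dG : R) :
  0 < (c s).1.2 -> is_derive ((c s).1.2) 1 psi dpsi ->
  is_derive ((c s).1.2) 1 G dG ->
  is_derive s 1 (fun x => (c x).1.1) v.1.1 ->
  is_derive s 1 (fun x => (c x).1.2) v.1.2 ->
  (forall i, is_derive s 1 (fun x => (c x).2 0 i) (v.2 0 i)) ->
  is_derive s 1 (fun x => sds_y_static m L alpha psi G (c x))
    (sds_velocity psi dpsi
      ((c s).1.1 - 1 / alpha * G (c s).1.2, (c s).1.2, (c s).2)
      (v.1.1 - 1 / alpha * (dG * v.1.2), v.1.2, v.2)).
Proof.
move=> r0 dps dGr dt dr dn.
pose c' x := ((c x).1.1 - 1 / alpha * G (c x).1.2, (c x).1.2, (c x).2).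
have d := is_derive1_comp (g := fun x => (c x).1.2) dGr dr.
have d' : is_derive s 1 (fun x => (c' x).1.1) (v.1.1 - 1 / alpha * (dG * v.1.2)).
  exact: is_deriveB dt (is_deriveZ (1 / alpha) d).
exact: (is_derive_sds_y (c := c')
  (v := (v.1.1 - 1 / alpha * (dG * v.1.2), v.1.2, v.2)) r0 dps d' dr dn).
Qed.

(** * The metric identity in static time, along curves and in spherical coordinates *)

Section StaticMetric.
Variables (psi G dpsi : R -> R) (C : set R).
Hypothesis C0 : forall r, C r -> 0 < r /\ sds_h m L r != 0.
Hypothesis psiE : forall r : R, 0 < r -> is_derive r 1 psi (dpsi r).
Hypothesis dpsiE : forall r, 0 < r -> dpsi r ^+ 2 = sds_R m L alpha r.
Hypothesis GE : forall r : R, C r ->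
  is_derive r 1 G (time_shift_integrand m L psi r).

Lemma time_shift_integrandE r : 0 < r ->
  time_shift_integrand m L psi r =
  sds_f m L r ^+ 2 * dpsi r / (1 - sds_f m L r ^+ 2).
Proof.
move=> r0; rewrite /time_shift_integrand derive1E.
by rewrite (@derive_val _ _ _ _ _ _ _ (psiE r0)).
Qed.

Lemma induces_metric_sds_y_static :
  induces_metric (spacetime setT C) (sds_y_static m L alpha psi G)
    (sds_metric m L).
Proof.
move=> p c d [_ Cr n1] cp dp; have [r0 h0] := C0 Cr.
have vel (e : R -> R * R * 'rV[R]_3) : curve_through (spacetime setT C) p e ->
    derive1 (sds_y_static m L alpha psi G \o e) 0 =
    sds_velocity psi (dpsi p.1.2) (p.1.1 - 1 / alpha * G p.1.2, p.1.2, p.2)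
      ((derive1 e 0).1.1 -
       1 / alpha * (time_shift_integrand m L psi p.1.2 * (derive1 e 0).1.2),
       (derive1 e 0).1.2, (derive1 e 0).2).
  move=> ep; have ev := curve_through_derive ep.
  have e0 : e 0 = p by case: ep.
  have r0' : 0 < (e 0).1.2 by rewrite e0.
  have Cr' : C (e 0).1.2 by rewrite e0.
  have := is_derive_sds_y_static r0' (psiE r0') (GE Cr') (is_derive_time ev)
    (is_derive_radius ev) (is_derive_direction ev).
  by rewrite e0 => D; rewrite derive1E (@derive_val _ _ _ _ _ _ _ D).
rewrite (vel _ cp) (vel _ dp).
apply: minkowski_sds_velocity => //.
- exact: curve_through_tangent cp.
- exact: curve_through_tangent dp.
- exact: dpsiE.
- exact: time_shift_integrandE.
Qed.

Definition spherical_chart (x : 'rV[R]_4) : R * R * 'rV[R]_3 :=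
  (x 0 0, x 0 1, spherical (x 0 2%:R) (x 0 3%:R)).

(** The differential of [spherical_chart] at [x] applied to [e]. *)
Definition spherical_velocity (x e : 'rV[R]_4) : R * R * 'rV[R]_3 :=
  let th := x 0 2%:R in let ph := x 0 3%:R in
  let dth := e 0 2%:R in let dph := e 0 3%:R in
  (e 0 0, e 0 1,
   \row_(i < 3) [:: - sin th * dth;
                    cos th * dth * cos ph - sin th * (sin ph * dph);
                    cos th * dth * sin ph + sin th * (cos ph * dph)]`_i).

Lemma is_derive_line (x e : 'rV[R]_4) i :
  is_derive (0 : R) 1 (fun s => (s *: e + x) 0 i) (e 0 i).
Proof.
have d := is_deriveD (is_deriveZ (e 0 i) (is_derive_id (0 : R) 1))
  (is_derive_cst (x 0 i) (0 : R) 1).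
rewrite (_ : (fun s => _) = e 0 i \*: id + cst (x 0 i)).
  by apply: (is_derive_eq d); rewrite addr0; exact: mulr1.
by apply/funext => s; rewrite !mxE; congr (_ + _); exact: mulrC.
Qed.

Lemma is_derive_spherical_direction (x e : 'rV[R]_4) i :
  is_derive (0 : R) 1 (fun s => (spherical_chart (s *: e + x)).2 0 i)
    ((spherical_velocity x e).2 0 i).
Proof.
have th := is_derive_line x e 2%:R; have ph := is_derive_line x e 3%:R.
have x0 j : (0 *: e + x) 0 j = x 0 j by rewrite scale0r add0r.
have sth := is_derive1_comp (g := fun s => (s *: e + x) 0 2%:R) (is_derive_sin _) th.
have cth := is_derive1_comp (g := fun s => (s *: e + x) 0 2%:R) (is_derive_cos _) th.
have sph := is_derive1_comp (g := fun s => (s *: e + x) 0 3%:R) (is_derive_sin _) ph.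
have cph := is_derive1_comp (g := fun s => (s *: e + x) 0 3%:R) (is_derive_cos _) ph.
rewrite mxE; case: i => [[|[|[|//]]] i3] /=.
- rewrite [X in is_derive _ _ X](_ : _ = fun s => cos ((s *: e + x) 0 2%:R)).
    by apply: (is_derive_eq cth); rewrite x0.
  by apply/funext => s; rewrite mxE.
- rewrite [X in is_derive _ _ X](_ : _ = fun s => sin ((s *: e + x) 0 2%:R) *
    cos ((s *: e + x) 0 3%:R)).
    apply: (is_derive_eq (is_deriveM sth cph)).
    by rewrite /GRing.scale /= !x0; ring.
  by apply/funext => s; rewrite mxE.
- rewrite [X in is_derive _ _ X](_ : _ = fun s => sin ((s *: e + x) 0 2%:R) *
    sin ((s *: e + x) 0 3%:R)).
    apply: (is_derive_eq (is_deriveM sth sph)).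
    by rewrite /GRing.scale /= !x0; ring.
  by apply/funext => s; rewrite mxE.
Qed.

(** The mixed terms in theta and phi cancel, and [cos ^+ 2 + sin ^+ 2 = 1], first in phi and then in
    theta, leaves a diagonal form. *)
Lemma sds_metric_spherical (x d e : 'rV[R]_4) :
  sds_metric m L (spherical_chart x) (spherical_velocity x d)
    (spherical_velocity x e) =
  \sum_i d 0 i * e 0 i * sds_metric_coord m L x i i.
Proof.
rewrite big_ord4 /sds_metric_coord /sds_metric big_ord3 !mxE !eqxx /=.
set h := sds_h m L _; set r := x 0 1.
set th := x 0 2%:R; set ph := x 0 3%:R.
set d0 := d 0 0; set d1 := d 0 1; set d2 := d 0 2%:R; set d3 := d 0 3%:R.
set e0 := e 0 0; set e1 := e 0 1; set e2 := e 0 2%:R; set e3 := e 0 3%:R.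
transitivity (h * (d0 * e0) - d1 * e1 / h - r ^+ 2 *
  (sin th ^+ 2 * (d2 * e2) + (cos th ^+ 2 * (d2 * e2) + sin th ^+ 2 * (d3 * e3))
   * (cos ph ^+ 2 + sin ph ^+ 2))).
  by rewrite /th /ph; ring.
rewrite cos2Dsin2 mulr1 cos2sin2; ring.
Qed.

Lemma spherical_chart_sphere x :
  \sum_(i < 3) (spherical_chart x).2 0 i ^+ 2 = 1.
Proof.
rewrite big_ord3 !mxE /= !exprMn -addrA -mulrDr cos2Dsin2 mulr1.
exact: cos2Dsin2.
Qed.

Lemma spherical_velocity_tangent x e :
  \sum_(i < 3) (spherical_chart x).2 0 i * (spherical_velocity x e).2 0 i = 0.
Proof.
rewrite big_ord3 !mxE /=; set th := x 0 2%:R; set ph := x 0 3%:R.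
transitivity (sin th * cos th * e 0 2%:R * (cos ph ^+ 2 + sin ph ^+ 2 - 1)).
  by rewrite /th /ph; ring.
by rewrite cos2Dsin2 subrr mulr0.
Qed.

(** The chart carries the coordinate line in direction [mu] to a curve through [spherical_chart x],
    so [is_derive_sds_y_static] applies; entry [a] is then read off linearly. *)
Lemma partial_sds_y_coord (x : 'rV[R]_4) a mu : C (x 0 1) ->
  partial (fun z => sds_y_coord m L alpha psi G z 0 a) mu x =
  sds_velocity psi (dpsi (x 0 1))
    (x 0 0 - 1 / alpha * G (x 0 1), x 0 1, (spherical_chart x).2)
    ((spherical_velocity x (delta_mx 0 mu)).1.1
      - 1 / alpha * (time_shift_integrand m L psi (x 0 1) *
          (spherical_velocity x (delta_mx 0 mu)).1.2),
     (spherical_velocity x (delta_mx 0 mu)).1.2,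
     (spherical_velocity x (delta_mx 0 mu)).2) 0 a.
Proof.
move=> Cr; have [r0 _] := C0 Cr; rewrite /partial; set e := delta_mx 0 mu.
pose c (s : R) := spherical_chart (s *: e + x).
have c0 : c 0 = spherical_chart x by rewrite /c scale0r add0r.
have r0' : 0 < (c 0).1.2 by rewrite c0.
have Cr' : C (c 0).1.2 by rewrite c0.
have vel := is_derive_sds_y_static r0' (psiE r0') (GE Cr')
  (v := spherical_velocity x e) (is_derive_line x e 0) (is_derive_line x e 1)
  (is_derive_spherical_direction x e).
rewrite c0 in vel.
have vela := is_derive_linear (f := fun y : 'rV[R]_6 => y 0 a)
  (@linear_coord R 6 a) (@coord_continuous _ _ _ _ _) vel.
by rewrite derive_line (@derive_val _ _ _ _ _ _ _ vela).
Qed.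

Lemma induced_metric_sds_y_coord (x : 'rV[R]_4) : C (x 0 1) ->
  induced_metric (sds_y_coord m L alpha psi G) x = sds_metric_coord m L x.
Proof.
move=> Cr; have [r0 h0] := C0 Cr; apply/matrixP => mu nu.
rewrite mxE; under eq_bigr => a _.
  under eq_bigr => b _ do rewrite !partial_sds_y_coord//.
  over.
rewrite -/(Defs.minkowski _ _).
transitivity (sds_metric m L (spherical_chart x)
    (spherical_velocity x (delta_mx 0 mu)) (spherical_velocity x (delta_mx 0 nu))).
  apply: minkowski_sds_velocity => //=.
  - exact: spherical_chart_sphere.
  - exact: spherical_velocity_tangent.
  - exact: spherical_velocity_tangent.
  - exact: dpsiE.
  - exact: time_shift_integrandE.
(* On basis vectors only the summand [i = mu] can survive, and it does so only for [mu = nu]. *)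
rewrite sds_metric_spherical (bigD1 mu)//= big1 => [|i /negbTE imu].
  rewrite !mxE !eqxx /= addr0 mul1r mulr1n.
  by case: eqVneq => [->|_]; rewrite ?mul1r ?mul0r.
by rewrite !mxE imu !mul0r.
Qed.

End StaticMetric.
End Velocity.

Unset Implicit Arguments.

Theorem mainTheorem1 (R : realType) (m L alpha : R)
    (hm : 0 < m) (hL : 0 < L)
    (halpha : 1 / (6 * Num.sqrt 3 * m) <= alpha) :
  (forall r : R, 0 < r -> sds_h m L r = 1 - sds_f m L r ^+ 2) /\
  (forall r : R, 0 < r -> 0 <= sds_R m L alpha r) /\
  (exists sigma : R -> R, smooth_sign_choice m L alpha sigma) /\
  (forall sigma : R -> R, smooth_sign_choice m L alpha sigma ->
   forall psi : R -> R,
     (forall r : R, 0 < r ->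
        is_derive r 1 psi (sigma r * Num.sqrt (sds_R m L alpha r))) ->
     smooth_embedding (spacetime setT [set r : R | 0 < r])
       (sds_y m L alpha psi) /\
     (forall r0 : R, 0 < r0 -> sds_h m L r0 != 0 ->
      let C := connected_component
                 [set r : R | 0 < r /\ sds_h m L r != 0] r0 in
      forall G : R -> R,
        (forall r : R, C r ->
           is_derive r 1 G (time_shift_integrand m L psi r)) ->
        induces_metric (spacetime setT C) (sds_y_static m L alpha psi G)
          (sds_metric m L) /\
        (forall x : 'rV[R]_4, C (x 0 1) ->
           induced_metric (sds_y_coord m L alpha psi G) x =
           sds_metric_coord m L x))).
Proof.
have alpha0 := alpha_gt0 hm halpha.
split; first by move=> r; exact: sds_h_f.
split; first by move=> r r0; exact/ltW/(sds_R_gt0 hm hL halpha).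
split; first by exists (fun=> 1); exact: smooth_sign_choice1.
move=> sigma [sigma1 ssigma] psi psiE.
split; first exact: (smooth_embedding_sds_y alpha hm hL ssigma psiE).
move=> r0 r0_gt0 h0 C G GE.
have C0 r : C r -> 0 < r /\ sds_h m L r != 0 by exact: connected_component_sub.
(* The sign enters only through its square, so every admissible choice gives the same metric. *)
have dpsiE (r : R) : 0 < r ->
    (sigma r * Num.sqrt (sds_R m L alpha r)) ^+ 2 = sds_R m L alpha r.
  move=> r_gt0; rewrite exprMn sqr_sqrtr ?(ltW (sds_R_gt0 hm hL halpha r_gt0))//.
  by case: (sigma1 r r_gt0) => ->; rewrite ?sqrrN expr1n mul1r.
split; first exact: (induces_metric_sds_y_static hm hL alpha0 C0 psiE dpsiE GE).
move=> x Cx.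
exact: (induced_metric_sds_y_coord hm hL alpha0 C0 psiE dpsiE GE Cx).
Qed.
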